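(* Let $r,f_1,\dots,f_n,g_1,\dots,g_n:\mathbb{R}^d\to\mathbb{R}\cup\{\infty\}$ be convex, closed, and proper. Assume $f_1,\dots,f_n$ are differentiable and have $L$-Lipschitz continuous gradients. Assume the Lagrangian $\mathcal{L}$ (defined in the context) has a saddle point, and let $0<\alpha<3/(2L)$. Let the iterates be generated by the method (PPG) of the context from an arbitrary starting point $\mathbf{z}^0\in\mathbb{R}^{dn}$, let $x^\star$ be a solution of $\text{minimize}_{x}\; r(x)+\frac1n\sum_{i=1}^n (f_i(x)+g_i(x))$, and define $$E^k=r(x^{k+1/2})+\frac1n\sum_{i=1}^n f_i(x^{k+1/2})+\frac1n\sum_{i=1}^n g_i(x_i^{k+1})-\Big(r(x^\star)+\frac1n\sum_{i=1}^n f_i(x^\star)+\frac1n\sum_{i=1}^n g_i(x^\star)\Big).$$ Then $$|E^k|\le\mathcal{O}(1/\sqrt{k}).$$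
   Context: For a convex, closed, proper $h$, $\mathrm{prox}_h(x_0)=\operatorname{argmin}_x\{h(x)+\frac12\|x-x_0\|_2^2\}$. Boldface denotes tuples of $n$ vectors of $\mathbb{R}^d$: $\mathbf{z}=(z_1,\dots,z_n)\in\mathbb{R}^{dn}$. (PPG), with stepsize $\alpha>0$: $x^{k+1/2}=\mathrm{prox}_{\alpha r}\big(\frac1n\sum_{i=1}^n z_i^k\big)$; for all $i=1,\dots,n$, $x_i^{k+1}=\mathrm{prox}_{\alpha g_i}\big(2x^{k+1/2}-z_i^k-\alpha\nabla f_i(x^{k+1/2})\big)$ and $z_i^{k+1}=z_i^k+x_i^{k+1}-x^{k+1/2}$. The Lagrangian is $\mathcal{L}(x,\mathbf{x},\boldsymbol{\nu})=r(x)+\frac1n\sum_{i=1}^n (f_i(x_i)+g_i(x_i))+\frac1n\sum_{i=1}^n\nu_i^T(x_i-x)$, for $x\in\mathbb{R}^d$, $\mathbf{x},\boldsymbol{\nu}\in\mathbb{R}^{dn}$; a saddle point is minimal in $(x,\mathbf{x})$ and maximal in $\boldsymbol{\nu}$. $\mathcal{O}(\cdot)$ is as $k\to\infty$, with constants independent of $k$. *)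

(* Defs.v *)
From HB Require Import structures.
From mathcomp Require Import all_boot all_order all_algebra.
From mathcomp Require Import all_classical all_reals all_analysis.

Set Implicit Arguments.
Unset Strict Implicit.
Unset Printing Implicit Defensive.

Import Order.TTheory GRing.Theory Num.Theory.
Import numFieldNormedType.Exports.

Local Open Scope classical_set_scope.
Local Open Scope ring_scope.

(* The library norm on 'rV[R]_d is the sup norm; the Euclidean one is needed
   for the prox and for the Lipschitz constant of the gradients. *)
Definition dotv (R : realType) (d : nat) (u v : 'rV[R]_d) : R :=
  \sum_(j < d) u 0 j * v 0 j.

Definition norm2 (R : realType) (d : nat) (u : 'rV[R]_d) : R :=
  Num.sqrt (dotv u u).

(* The codomain R \cup {+oo} is \bar R without -oo, which properness excludes. *)
Definition proper_fun (R : realType) (d : nat) (h : 'rV[R]_d -> \bar R) : Prop :=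
  (forall x, h x != -oo%E) /\ (exists x, h x \is a fin_num).

(* Convexity is only meant for functions that never take the value -oo;
   in \bar R, 0 * +oo = 0. *)
Definition convex_fun (R : realType) (d : nat) (h : 'rV[R]_d -> \bar R) : Prop :=
  forall (x y : 'rV[R]_d) (t : R), 0 <= t <= 1 ->
    (h (t *: x + (1 - t) *: y)%R <= t%:E * h x + (1 - t)%R%:E * h y)%E.

Definition closed_fun (R : realType) (d : nat) (h : 'rV[R]_d -> \bar R) : Prop :=
  closed [set p : 'rV[R]_d * R | (h p.1 <= p.2%:E)%E].

Definition ccp (R : realType) (d : nat) (h : 'rV[R]_d -> \bar R) : Prop :=
  [/\ convex_fun h, closed_fun h & proper_fun h].

Definition differentiable_fun (R : realType) (d : nat)
    (h : 'rV[R]_d -> \bar R) : Prop :=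
  forall x, h x \is a fin_num /\ differentiable (fine \o h) x.

Definition grad (R : realType) (d : nat) (h : 'rV[R]_d -> \bar R)
    (x : 'rV[R]_d) : 'rV[R]_d :=
  \row_(j < d) 'D_(delta_mx 0 j) (fine \o h) x.

Definition lipschitz_grad (R : realType) (d : nat) (L : R)
    (h : 'rV[R]_d -> \bar R) : Prop :=
  forall x y, norm2 (grad h x - grad h y) <= L * norm2 (x - y).

Definition argmin (T : Type) (R : realType) (h : T -> \bar R) : set T :=
  [set x | forall y, (h x <= h y)%E].

(* For h convex, closed and proper the argmin is a singleton and [get] returns
   its element. *)
Definition prox (R : realType) (d : nat) (h : 'rV[R]_d -> \bar R)
    (x0 : 'rV[R]_d) : 'rV[R]_d :=
  get (argmin (fun x => (h x + (2^-1 * norm2 (x - x0) ^+ 2)%R%:E)%E)).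

Definition emean (R : realType) (n : nat) (a : 'I_n -> \bar R) : \bar R :=
  ((n%:R^-1)%:E * \sum_(i < n) a i)%E.

Definition objective (R : realType) (d n : nat) (r : 'rV[R]_d -> \bar R)
    (f g : 'I_n -> 'rV[R]_d -> \bar R) (x : 'rV[R]_d) : \bar R :=
  (r x + emean (fun i => f i x + g i x))%E.

Definition lagrangian (R : realType) (d n : nat) (r : 'rV[R]_d -> \bar R)
    (f g : 'I_n -> 'rV[R]_d -> \bar R)
    (x : 'rV[R]_d) (xs nu : 'I_n -> 'rV[R]_d) : \bar R :=
  (r x + emean (fun i => f i (xs i) + g i (xs i))
       + (n%:R^-1 * \sum_(i < n) dotv (nu i) (xs i - x))%R%:E)%E.

Definition saddle_point (R : realType) (d n : nat) (r : 'rV[R]_d -> \bar R)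
    (f g : 'I_n -> 'rV[R]_d -> \bar R)
    (x : 'rV[R]_d) (xs nu : 'I_n -> 'rV[R]_d) : Prop :=
  (forall y ys, (lagrangian r f g x xs nu <= lagrangian r f g y ys nu)%E) /\
  (forall mu, (lagrangian r f g x xs mu <= lagrangian r f g x xs nu)%E).

(* [xh k] is x^{k+1/2}; [x 0] is irrelevant and left unconstrained. *)
Definition PPG (R : realType) (d n : nat) (alpha : R) (r : 'rV[R]_d -> \bar R)
    (f g : 'I_n -> 'rV[R]_d -> \bar R)
    (xh : nat -> 'rV[R]_d) (x z : nat -> 'I_n -> 'rV[R]_d) : Prop :=
  forall k : nat,
  [/\ xh k = prox (fun y => alpha%:E * r y)%E (n%:R^-1 *: \sum_(i < n) z k i),
      forall i, x k.+1 i =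
        prox (fun y => alpha%:E * g i y)%E
             (2 *: xh k - z k i - alpha *: grad (f i) (xh k))
    & forall i, z k.+1 i = z k i + x k.+1 i - xh k].

Definition PPG_gap (R : realType) (d n : nat) (r : 'rV[R]_d -> \bar R)
    (f g : 'I_n -> 'rV[R]_d -> \bar R) (xstar : 'rV[R]_d)
    (xh : nat -> 'rV[R]_d) (x : nat -> 'I_n -> 'rV[R]_d) (k : nat) : \bar R :=
  (r (xh k) + emean (fun i => f i (xh k)) + emean (fun i => g i (x k.+1 i))
   - (r xstar + emean (fun i => f i xstar) + emean (fun i => g i xstar)))%E.

(* Main.v *)
Require Import Defs.
From HB Require Import structures.
From mathcomp Require Import all_boot all_order all_algebra.
From mathcomp Require Import all_classical all_reals all_analysis.
From mathcomp Require Import ring lra.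
Set Implicit Arguments.
Unset Strict Implicit.
Unset Printing Implicit Defensive.
Import Order.TTheory GRing.Theory Num.Theory.
Import numFieldNormedType.Exports.
Local Open Scope classical_set_scope.
Local Open Scope ring_scope.

(** The method is a three-operator (Davis-Yin) splitting iteration for z, whose
    map T is averaged when [alpha * L < 2]; the stepsize condition gives
    [alpha * L < 3 / 2]. Averagedness ([ppg_averaged]) is monotonicity of the
    subdifferentials of r and of the g_i, which the optimality conditions of the
    proximal steps bring in ([prox_subgrad]), combined with cocoercivity of the
    gradients ([cocoercive]).

    A saddle point (x, (x_i), nu) has all x_i equal to x
    ([saddle_point_consensus]), and its minimality says that the mean of the
    nu_i is a subgradient of r at x and that - nu_i - grad f_i(x) is one of g_i
    ([saddle_subgrad_r], [saddle_subgrad_g]). So z* = x + alpha nu is a fixed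
    point of T. Moreover x is a minimizer of the objective, so the optimal value
    that enters E^k may be computed at x instead of at the given solution.

    Averagedness against z* bounds all iterates and makes the squared steps
    |z^{k+1} - z^k|^2 summable; averagedness against the previous iterate makes
    them nonincreasing. Together the squared step is O(1/k) ([residual_rate]).

    Adding the subgradient inequalities at the current iterate, evaluated at the
    fixed point, the terms in w - x cancel and leave
    n alpha E^k <= sum_i <c_i, z_i^{k+1} - z_i^k> with bounded c_i ([gap_upper]).
    The same inequalities with the iterate and the fixed point exchanged give a
    lower bound of the same shape ([gap_lower]). A step of length O(1/sqrt k)
    paired with bounded vectors is O(1/sqrt k).

    Each proximal point must be shown to exist: a convex, closed, proper function
    has a linear lower bound, so adding the quadratic term makes it coercive, and
    a closed function attains its minimum on compact sets
    ([prox_objective_argmin_exists]). *)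

(** * The Euclidean inner product on row vectors *)

Section Dotv.
Context {R : realType} {d : nat}.
Implicit Types (u v w : 'rV[R]_d) (c : R).

Lemma dotvC u v : dotv u v = dotv v u.
Proof. by apply: eq_bigr => j _; rewrite mulrC. Qed.

Lemma dotvDl u v w : dotv (u + v) w = dotv u w + dotv v w.
Proof. by rewrite -big_split; apply: eq_bigr => j _; rewrite mxE mulrDl. Qed.

Lemma dotvZl c u w : dotv (c *: u) w = c * dotv u w.
Proof. by rewrite /dotv mulr_sumr; apply: eq_bigr => j _; rewrite mxE mulrA. Qed.

Lemma dotvNl u w : dotv (- u) w = - dotv u w.
Proof. by rewrite -scaleN1r dotvZl mulN1r. Qed.

Lemma dotvDr u v w : dotv w (u + v) = dotv w u + dotv w v.
Proof. by rewrite dotvC dotvDl !(dotvC _ w). Qed.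

Lemma dotvZr c u w : dotv w (c *: u) = c * dotv w u.
Proof. by rewrite dotvC dotvZl dotvC. Qed.

Lemma dotvNr u w : dotv w (- u) = - dotv w u.
Proof. by rewrite dotvC dotvNl dotvC. Qed.

Lemma dotv0r u : dotv u 0 = 0.
Proof. by rewrite -(scale0r 0) dotvZr mul0r. Qed.

Definition dotvE := (dotvDl, dotvDr, dotvNl, dotvNr, dotvZl, dotvZr).

Lemma dotv_suml (I : finType) (F : I -> 'rV[R]_d) w :
  dotv (\sum_i F i) w = \sum_i dotv (F i) w.
Proof.
elim/big_rec2: _ => [|i a b _ <-]; last by rewrite dotvDl.
by rewrite dotvC dotv0r.
Qed.

Lemma dotv_ge0 u : 0 <= dotv u u.
Proof. by apply: sumr_ge0 => j _; rewrite -expr2 sqr_ge0. Qed.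

Lemma norm2_sqr u : norm2 u ^+ 2 = dotv u u.
Proof. by rewrite /norm2 sqr_sqrtr // dotv_ge0. Qed.

Lemma norm2_le_sqr c u v : norm2 u <= c * norm2 v ->
  dotv u u <= c ^+ 2 * dotv v v.
Proof.
move=> h; rewrite -!norm2_sqr -exprMn; apply: lerXn2r => //.
  by rewrite nnegrE sqrtr_ge0.
by rewrite nnegrE; apply: le_trans h; rewrite sqrtr_ge0.
Qed.

(** Young's inequality takes the place of Cauchy-Schwarz throughout: every bound
    below is on an inner product of two vectors whose squared lengths are
    controlled, and a good choice of [c] loses nothing. *)
Lemma dotv_young c u v : 0 < c ->
  2 * dotv u v <= c * dotv u u + c^-1 * dotv v v.
Proof.
move=> c0; have := dotv_ge0 (c *: u - v); rewrite !dotvE (dotvC v u) => h.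
rewrite -(ler_pM2l c0).
have -> : c * (c * dotv u u + c^-1 * dotv v v) = c * (c * dotv u u) + dotv v v.
  by field; rewrite gt_eqF.
lra.
Qed.

End Dotv.

(** * Smooth convex functions *)

(** First-order optimality without limits: perturbing a minimizer by a step [t]
    along a segment gives, after division by [t], an inequality whose error is
    linear in [t]. *)
Lemma le0_of_small_bounds {R : realFieldType} (a b : R) :
  (forall t, 0 < t <= 1 -> a <= t * b) -> a <= 0.
Proof.
move=> h; rewrite leNgt; apply/negP => a0.
have b0 : 0 < b by have := h 1; rewrite ltr01 lexx mul1r => /(_ isT); lra.
have ab : a <= b by have := h 1; rewrite ltr01 lexx mul1r => /(_ isT).
have /h : 0 < a / (2 * b) <= 1.
  apply/andP; split; first by rewrite divr_gt0 // mulr_gt0.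
  by rewrite ler_pdivrMr ?mulr_gt0 // mul1r; lra.
have -> : a / (2 * b) * b = a / 2 by field; rewrite gt_eqF.
lra.
Qed.

Lemma convex_comb_shift {R : pzRingType} {V : lmodType R} (t : R) (x y : V) :
  t *: y + (1 - t) *: x = x + t *: (y - x).
Proof. by rewrite scalerBl scale1r scalerBr addrC addrAC addrA. Qed.

Section Smooth.
Context {R : realType} {d : nat}.
Variables (h : 'rV[R]_d -> \bar R) (L : R).
Hypothesis hdiff : differentiable_fun h.
Implicit Types (x y v : 'rV[R]_d) (t : R).
Let F := fine \o h.

Lemma derive_dotv_grad x v : 'D_v F x = dotv (grad h x) v.
Proof.
have [_ df] := hdiff x.
rewrite deriveE // {1}(row_sum_delta v) linear_sum.
apply: eq_bigr => j _.
by rewrite linearZ /= /grad mxE -deriveE // mulrC.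
Qed.

Lemma is_derive_along_line x v t :
  is_derive t 1 (fun s : R => F (x + s *: v)) (dotv (grad h (x + t *: v)) v).
Proof.
have [_ df] := hdiff (x + t *: v).
have : derivable F (x + t *: v) v by exact: diff_derivable.
rewrite -derive_dotv_grad /derivable /derive /=.
have -> : (fun s : R => s^-1 *: ((F \o shift (x + t *: v)) (s *: v) - F (x + t *: v)))
  = (fun s : R => s^-1 *: (((fun s : R => F (x + s *: v)) \o shift t)
      (s *: (1 : R)) - F (x + t *: v))).
  apply/funext => s /=; congr (_ *: (F _ - _)).
  by rewrite scalerDl /GRing.scale /= mulr1 addrCA.
by move=> cv; apply: DeriveDef.
Qed.

Hypotheses (L0 : 0 < L) (hlip : lipschitz_grad L h).

Lemma grad_increment_le x v t : 0 < t ->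
  `| dotv (grad h (x + t *: v) - grad h x) v | <= t * (L * dotv v v).
Proof.
move=> t0; set G := grad h _ - _.
have GG : dotv G G <= L ^+ 2 * (t ^+ 2 * dotv v v).
  have := norm2_le_sqr (hlip (x + t *: v) x).
  by rewrite -/G [x + _]addrC addrK dotvZl dotvZr (expr2 t) -mulrA.
have c0 : 0 < (L * t)^-1 by rewrite invr_gt0 mulr_gt0.
have key : (L * t)^-1 * dotv G G <= t * (L * dotv v v).
  rewrite mulrC ler_pdivrMr ?mulr_gt0 //; apply: (le_trans GG).
  by rewrite le_eqVlt; apply/orP; left; apply/eqP; ring.
have := dotv_young G v c0; have := dotv_young (- G) v c0.
rewrite !(dotvNl, dotvNr) opprK invrK ler_norml.
by move=> h1 h2; apply/andP; split; lra.
Qed.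

(** The function minus its linear part at [x] minus [L / 2] times the squared
    step has a nonpositive derivative along the segment. The two signs [s]
    treat the upper and the lower estimate together. *)
Lemma quadratic_approx x v :
  `| F (x + v) - F x - dotv (grad h x) v | <= L / 2 * dotv v v.
Proof.
have step (s : R) : s ^+ 2 = 1 ->
    s * (F (x + v) - F x - dotv (grad h x) v) <= L / 2 * dotv v v.
  move=> s1.
  pose psi := fun t : R => s * (F (x + t *: v) - t * dotv (grad h x) v)
     - L / 2 * dotv v v * t ^+ 2.
  pose dpsi := fun t : R => s * (dotv (grad h (x + t *: v) - grad h x) v)
     - t * (L * dotv v v).
  have scalE (a b : R) : a *: b = a * b by [].
  have dpsiP t : is_derive t 1 psi (dpsi t).
    have H := is_derive_along_line x v t.
    have -> : psi = (s \*: ((fun s : R => F (x + s *: v)) - (dotv (grad h x) v) \*: id))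
       - ((L / 2 * dotv v v) \*: (id ^+ 2)).
      by apply/funext => u; rewrite /psi !fctE /= !scalE; ring.
    apply: is_derive_eq.
    rewrite /dpsi dotvDl dotvNl !scalE /=; by field.
  have psi_cont : {within `[0, 1], continuous psi}.
    by apply: derivable_within_continuous => u _; case: (dpsiP u).
  have [c] := MVT (f := psi) (df := dpsi) (@ltr01 R) (fun u _ => dpsiP u)
    psi_cont.
  rewrite in_itv /= => /andP[c0 c1].
  rewrite subr0 mulr1 /psi /dpsi scale1r scale0r addr0.
  have := grad_increment_le x v c0; rewrite ler_norml.
  have : s = 1 \/ s = -1.
    by move/eqP: s1; rewrite sqrf_eq1 => /orP[] /eqP; [left|right].
  by case=> ->; lra.
have := step 1 (expr1n _ _); have := step (-1) (etrans (sqrrN 1) (expr1n _ 2)).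
by move=> a b; rewrite ler_norml; apply/andP; split; lra.
Qed.

Hypothesis hconv : convex_fun h.

(** The two-sided quadratic estimate makes the secant slope over a
    step [t] differ from the directional derivative by O(t), so convexity
    yields the tangent inequality as [t] shrinks. *)
Lemma convex_grad_ineq x y : F x + dotv (grad h x) (y - x) <= F y.
Proof.
rewrite -subr_le0.
apply: (@le0_of_small_bounds _ _ (L / 2 * dotv (y - x) (y - x))) => t /andP[t0 t1].
have := hconv y x (t := t); rewrite (ltW t0) t1 => /(_ isT).
have [fx _] := hdiff x; have [fy _] := hdiff y.
have [fz _] := hdiff (t *: y + (1 - t) *: x).
rewrite -(fineK fx) -(fineK fy) -(fineK fz) -!EFinM -EFinD lee_fin.
rewrite convex_comb_shift.
have := quadratic_approx x (t *: (y - x)); rewrite ler_norml !dotvE /F /=.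
move=> /andP[h1 _] h2; rewrite -(ler_pM2l t0); lra.
Qed.

(** A gradient step of length [1 / L] from [y], for the function minus its
    linear part at [x], decreases it by the squared gradient over [2 * L]; the
    tangent inequality says that it cannot fall below its value at [x]. *)
Lemma cocoercive_grad_ineq x y :
  F x + dotv (grad h x) (y - x)
    + (2 * L)^-1 * dotv (grad h y - grad h x) (grad h y - grad h x) <= F y.
Proof.
set G := grad h y - grad h x; pose u := L^-1 *: G.
have h1 := convex_grad_ineq x (y - u).
have := quadratic_approx y (- u); rewrite ler_norml => /andP[_ h2].
have GG : dotv (grad h y) G - dotv (grad h x) G = dotv G G by rewrite -dotvNl -dotvDl.
have e1 : L / 2 * (L^-1 * (L^-1 * dotv G G)) = (2 * L)^-1 * dotv G G.
  by field; rewrite gt_eqF.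
have e2 : L^-1 * dotv (grad h y) G - L^-1 * dotv (grad h x) G =
    2 * ((2 * L)^-1 * dotv G G).
  by rewrite -mulrBr GG; field; rewrite gt_eqF.
move: h1 h2; rewrite (addrAC y) (dotvDr _ (- u)) !(dotvNl, dotvNr) !opprK /u.
by rewrite !(dotvZl, dotvZr) e1; lra.
Qed.

(** The sum of the strengthened tangent inequalities at [x] and at [y]
    (Baillon-Haddad). *)
Lemma cocoercive x y :
  L^-1 * dotv (grad h x - grad h y) (grad h x - grad h y)
    <= dotv (grad h x - grad h y) (x - y).
Proof.
have := cocoercive_grad_ineq x y; have := cocoercive_grad_ineq y x.
rewrite -(opprB (grad h x)) (invfM 2 L) !dotvE; lra.
Qed.

End Smooth.

(** * Existence and optimality of the proximal point *)

Section ProxExists.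
Context {R : realType}.

(** The sublevel sets above the infimum, cut down to [K], form a filter base; a
    cluster point lies in all of them because they are closed. *)
Lemma lsc_attains_min_on_compact (T : topologicalType) (h : T -> \bar R)
    (K : set T) :
  compact K -> K !=set0 -> (forall a : R, closed [set x | (h x <= a%:E)%E]) ->
  exists2 x, K x & forall y, K y -> (h x <= h y)%E.
Proof.
move=> cK [k0 Kk0] clh; pose m := ereal_inf (h @` K).
have mle y : K y -> (m <= h y)%E by move=> Ky; apply: ereal_inf_lbound; exists y.
have [mE|m_fin] := eqVneq m +oo%E.
  by exists k0 => // y /mle; rewrite mE leye_eq => /eqP ->; rewrite leey.
have [a0 ma0] : exists a : R, (m < a%:E)%E.
  case: m m_fin {mle} => [s||] // _; last by exists 0; rewrite ltNyr.
  by exists (s + 1); rewrite lte_fin ltrDl.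
pose sub (a : R) := K `&` [set x | (h x <= a%:E)%E].
pose F := filter_from [set a : R | (m < a%:E)%E] sub.
have FF : ProperFilter F.
  apply: filter_from_proper.
    apply: filter_from_filter; first by exists a0.
    move=> a b /= ma mb; exists (Num.min a b); first by rewrite /= EFin_min lt_min ma mb.
    move=> x [Kx /=]; rewrite EFin_min le_min => /andP[xa xb].
    by split; split.
  move=> a /= /ereal_inf_lt[_ [x Kx <-] /ltW xa]; by exists x.
have FK : F K by exists a0 => // x [].
have [x [Kx clx]] := cK F FF FK; exists x => // y Ky.
apply: le_trans (mle _ Ky).
have xle a : (m < a%:E)%E -> (h x <= a%:E)%E.
  move=> ma; apply: (clh a) => B nB; apply: clx nB.
  by exists a => // w [].
rewrite leNgt; apply/negP => mx.
have [b mb bx] : exists2 b : R, (m < b%:E)%E & (b%:E < h x)%E.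
  move: mx m_fin; case: (m) => [s||] //; case: (h x) => [u||] // mx _.
  - by exists ((s + u) / 2); rewrite !lte_fin midf_lt.
  - by exists (s + 1); rewrite ?ltry // lte_fin ltrDl.
  - by exists (u - 1); rewrite ?ltNyr // lte_fin gtrDl ltrN10.
  - by exists 0; rewrite ?ltry ?ltNyr.
by have := xle _ mb; rewrite leNgt bx.
Qed.

Context {d : nat}.
Implicit Types (x y c : 'rV[R]_d) (h : 'rV[R]_d -> \bar R).

Lemma cball_compact c (rho : R) : compact [set y : 'rV[R]_d | `|y - c| <= rho].
Proof.
apply: bounded_closed_compact.
  exists (`|c| + rho); split; first exact: num_real.
  move=> M cM y /= yc; apply: le_trans (ltW cM).
  by rewrite -[y](subrK c) addrC; apply: le_trans (ler_normD _ _) _; rewrite lerD2l.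
apply: (@preimage_closed _ _ (fun y : 'rV[R]_d => `|y - c|) [set t | t <= rho]).
  move=> y _; apply: continuous_comp; last exact: norm_continuous.
  by apply: (@cvgB _ _ _ (nbhs y)); [exact: cvg_id|exact: cvg_cst].
exact: closed_le.
Qed.

Lemma continuous_graph (q : 'rV[R]_d -> R) :
  continuous q -> continuous (fun y => (y, q y)).
Proof.
move=> cq y; apply: (cvg_pair (F := nbhs y) (G := nbhs y) (H := nbhs (q y))).
  exact: cvg_id.
exact: cq.
Qed.

Lemma supnorm_sqr_le x : `|x| ^+ 2 <= dotv x x.
Proof.
have [->|x0] := eqVneq `|x| 0; first by rewrite expr0n dotv_ge0.
have [[i j] /= e] := mx_norm_neq0 x0.
rewrite [`|x|]e (ord1 i) real_normK ?num_real // /dotv (bigD1 j) //= expr2.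
by rewrite lerDl; apply: sumr_ge0 => l _; rewrite -expr2 sqr_ge0.
Qed.

(** This replaces the affine minorant that a separation theorem would give. The
    function is bounded below on a ball around a point [x1] of its domain, by
    compactness; a point [y] outside is reached by prolonging the segment from
    [x1] to the sphere, and convexity turns the bound on the ball into one that
    is linear in the distance. *)
Lemma ccp_linear_lower_bound h : ccp h ->
  exists (A : R) (x1 : 'rV[R]_d), [/\ 0 <= A, h x1 \is a fin_num &
    forall y, ((- (A * (`|y - x1| + 1)))%:E <= h y)%E].
Proof.
case=> hconv hcl [hNy [x1 fx1]].
have closed_sublevel (a : R) : closed [set x | (h x <= a%:E)%E].
  apply: (@preimage_closed _ _ (fun y : 'rV[R]_d => (y, a)) _ _ hcl) => y _.
  by apply: (continuous_graph (q := cst a)); exact: cst_continuous.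
have x1ball : [set y : 'rV[R]_d | `|y - x1| <= 1] x1 by rewrite /= subrr normr0.
have [w _ wmin] := lsc_attains_min_on_compact (@cball_compact x1 1)
  (ex_intro _ _ x1ball) closed_sublevel.
have fw : h w \is a fin_num.
  rewrite fin_numElt ltNye hNy /=.
  by apply: le_lt_trans (wmin _ x1ball) _; rewrite ltey_eq fx1.
exists (`|fine (h w)| + `|fine (h x1)|), x1; split => // y.
have [y1|y1] := leP `|y - x1| 1.
  apply: le_trans (wmin _ y1); rewrite -(fineK fw) lee_fin.
  have := ler_norm (- fine (h w)); rewrite normrN.
  have := normr_ge0 (fine (h x1)); have := normr_ge0 (fine (h w)).
  have := normr_ge0 (y - x1).
  nra.
pose t := `|y - x1|^-1.
have t0 : 0 < t by rewrite invr_gt0 (lt_trans _ y1).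
have t1 : t <= 1 by rewrite invf_le1 ?(ltW y1) // (lt_trans _ y1).
have := hconv y x1 t; rewrite (ltW t0) t1 => /(_ isT).
have /wmin : `|t *: y + (1 - t) *: x1 - x1| <= 1.
  rewrite convex_comb_shift [_ + _ - x1]addrC addKr.
  by rewrite normrZ gtr0_norm // mulVf // gt_eqF // (lt_trans _ y1).
move=> /le_trans h1 /h1 {h1}.
have := hNy y; case: (h y) => [b _| _ _|//]; last by rewrite leey.
rewrite -(fineK fw) -(fineK fx1) -!EFinM -EFinD !lee_fin /=.
rewrite -(ler_pM2l (_ : 0 < `|y - x1|)) ?(lt_trans _ y1) //.
have -> : `|y - x1| * (t * b + (1 - t) * fine (h x1)) =
  b + (`|y - x1| - 1) * fine (h x1).
  by rewrite /t; field; rewrite gt_eqF // (lt_trans _ y1).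
have := ler_norm (- fine (h w)); rewrite normrN.
have := ler_norm (fine (h x1)).
have := normr_ge0 (fine (h x1)); have := normr_ge0 (fine (h w)).
move: y1; set nu := `|y - x1|.
nra.
Qed.

Definition prox_objective (alpha : R) h x0 y : \bar R :=
  (alpha%:E * h y + (2^-1 * norm2 (y - x0) ^+ 2)%:E)%E.

Lemma dotv_continuous c : continuous (fun y : 'rV[R]_d => dotv (y - c) (y - c)).
Proof.
have coordB j : continuous (fun y : 'rV[R]_d => (y - c) 0 j).
  move=> y.
  have -> : (fun y : 'rV[R]_d => (y - c) 0 j) = (fun y => y 0 j - c 0 j).
    by apply/funext => u; rewrite !mxE.
  apply: (@cvgB _ _ _ (nbhs y)); last exact: cvg_cst.
  exact: coord_continuous.
rewrite /dotv; apply: continuous_big => [|j _ y].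
  exact: add_continuous.
by apply: (@cvgM _ _ (nbhs y)); exact: coordB.
Qed.

(** A sublevel set of the sum with a continuous function is the preimage of the
    epigraph under a graph map. *)
Lemma closed_prox_sublevel (alpha : R) h x0 (a : R) : 0 < alpha ->
  closed_fun h -> closed [set y | (prox_objective alpha h x0 y <= a%:E)%E].
Proof.
move=> alpha0 hcl.
pose q y : R := 2^-1 * dotv (y - x0) (y - x0).
have -> : [set y | (prox_objective alpha h x0 y <= a%:E)%E] =
    (fun y => (y, (a - q y) / alpha)) @^-1`
      [set p : 'rV[R]_d * R | (h p.1 <= p.2%:E)%E].
  apply/seteqP; split => y; rewrite /prox_objective /= norm2_sqr -/(q y);
    case: (h y) => [b||];
    rewrite ?gt0_muley ?gt0_muleNy ?lte_fin //= ?leNye //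
      -EFinM -EFinD !lee_fin ler_pdivlMr // [b * _]mulrC; lra.
apply: preimage_closed hcl => y _; apply: continuous_graph => {}y.
apply: (@cvgM _ _ (nbhs y)); last exact: cvg_cst.
apply: (@cvgB _ _ _ (nbhs y)); first exact: cvg_cst.
apply: (@cvgM _ _ (nbhs y)); first exact: cvg_cst.
exact: dotv_continuous.
Qed.

(** The quadratic term beats the linear lower bound, so that outside a large
    ball around [x1] the objective exceeds its value at [x1]; on that ball the
    minimum is attained. *)
Lemma prox_objective_argmin_exists (alpha : R) h x0 : 0 < alpha -> ccp h ->
  argmin (prox_objective alpha h x0) !=set0.
Proof.
move=> alpha0 hccp.
have [A [x1 [A0 fx1 hlow]]] := ccp_linear_lower_bound hccp.
have [_ hcl _] := hccp.
pose B := alpha * A; pose delta := `|x0 - x1|.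
pose c := alpha * fine (h x1) + 2^-1 * dotv (x1 - x0) (x1 - x0).
have cE : prox_objective alpha h x0 x1 = c%:E.
  by rewrite /prox_objective norm2_sqr -(fineK fx1).
pose Q : R := `|2 * B * (delta + 1) + 2 * c|.
(* The radius is such that u := `|y - x0| satisfies u ^+ 2 > 2 * B * u + Q
   whenever y is outside the ball. *)
pose rho := delta + 2 * B + 1 + Q.
have B0 : 0 <= B by rewrite mulr_ge0 // ltW.
have delta0 : 0 <= delta by exact: normr_ge0.
have Q0 : 0 <= Q by exact: normr_ge0.
have rho0 : 0 <= rho by rewrite /rho; lra.
have x1ball : [set y : 'rV[R]_d | `|y - x1| <= rho] x1 by rewrite /= subrr normr0.
have [p _ pmin] := lsc_attains_min_on_compact (@cball_compact x1 rho)
  (ex_intro _ _ x1ball) (fun a => @closed_prox_sublevel alpha h x0 a alpha0 hcl).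
exists p => y; have [/pmin //|ybig] := leP `|y - x1| rho.
apply: le_trans (pmin _ x1ball) _; rewrite cE.
have tri : `|y - x1| <= `|y - x0| + delta.
  by rewrite -[y - x1](subrKA x0); exact: ler_normD.
have := supnorm_sqr_le (y - x0).
have := hlow y; rewrite /prox_objective norm2_sqr; case: (h y) => [b||//]; last first.
  by rewrite gt0_muley ?lte_fin // => _ _; rewrite leey.
rewrite -EFinM -EFinD !lee_fin -(ler_pM2l alpha0) => h1 h2.
have {}h1 : - (B * (`|y - x0| + delta + 1)) <= alpha * b.
  apply: le_trans h1; rewrite mulrN mulrA -/B lerN2 ler_wpM2l // lerD2r //.
have Qge : 2 * B * (delta + 1) + 2 * c <= Q by exact: ler_norm.
have u1 : 2 * B + 1 + Q <= `|y - x0| by move: ybig; rewrite /rho; lra.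
have u2 : (2 * B + 1 + Q) * `|y - x0| <= `|y - x0| ^+ 2.
  by rewrite expr2 ler_wpM2r.
have u3 : Q <= Q * `|y - x0| by rewrite ler_peMr //; lra.
have u4 : 0 <= `|y - x0| by [].
nra.
Qed.

(** The subdifferential relation. Only points of the domain are tested, so that
    the inequality is one between reals. *)
Definition subgrad h x (u : 'rV[R]_d) : Prop :=
  h x \is a fin_num /\
  forall y, h y \is a fin_num -> fine (h x) + dotv u (y - x) <= fine (h y).

(** The optimality condition of the proximal minimization, which is all that the
    convergence analysis uses about it. *)
Lemma prox_subgrad (alpha : R) h x0 : 0 < alpha -> ccp h ->
  let p := prox (fun y => alpha%:E * h y)%E x0 in
  subgrad h p (alpha^-1 *: (x0 - p)).
Proof.
move=> alpha0 hccp p.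
have : argmin (prox_objective alpha h x0) p.
  exact: (getPex (prox_objective_argmin_exists x0 alpha0 hccp)).
have [hconv _ [hNy [x1 fx1]]] := hccp.
clearbody p => pmin.
have fp : h p \is a fin_num.
  have := pmin x1; have := hNy p; rewrite /prox_objective -(fineK fx1).
  by case: (h p) => [b||//] // _; rewrite gt0_muley ?lte_fin.
split => // y fy; rewrite dotvZl -subr_le0.
apply: (@le0_of_small_bounds _ _ (alpha^-1 * 2^-1 * dotv (y - p) (y - p))).
move=> t /andP[t0 t1].
have := hconv y p t; rewrite (ltW t0) t1 => /(_ isT).
have := pmin (t *: y + (1 - t) *: p).
rewrite convex_comb_shift.
rewrite /prox_objective !norm2_sqr -(fineK fp) -(fineK fy) -!EFinM -!EFinD.
case: (h _) (hNy (p + t *: (y - p))) => [b _||//]; last by [].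
rewrite -EFinM -EFinD !lee_fin /= addrAC (dotvDl (p - x0)) (dotvDr (p - x0)).
rewrite (dotvDr (p - x0)) !dotvZl !dotvZr (dotvC (y - p)).
have -> : dotv (p - x0) (y - p) = - dotv (x0 - p) (y - p).
  by rewrite -dotvNl opprB.
move=> h1 h2; rewrite -(ler_pM2l alpha0) -(ler_pM2l t0).
have -> : t * (alpha * (t * (alpha^-1 / 2 * dotv (y - p) (y - p)))) =
   t * (t * dotv (y - p) (y - p)) / 2 by field; rewrite gt_eqF.
have -> : t * (alpha * (fine (h p) + alpha^-1 * dotv (x0 - p) (y - p) - fine (h y)))
  = t * (alpha * fine (h p) + dotv (x0 - p) (y - p) - alpha * fine (h y)).
  by field; rewrite gt_eqF.
have h3 : alpha * b <= alpha * (t * fine (h y) + (1 - t) * fine (h p)).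
  by rewrite ler_pM2l.
lra.
Qed.

End ProxExists.

(** * Saddle points of the Lagrangian *)

Section Saddle.
Context {R : realType} {d n : nat}.
Variables (r : 'rV[R]_d -> \bar R) (f g : 'I_n -> 'rV[R]_d -> \bar R).
Hypotheses (hn : (0 < n)%N) (hr : ccp r) (hg : forall i, ccp (g i)).
Hypothesis hdf : forall i, differentiable_fun (f i).
Implicit Types (x y : 'rV[R]_d) (xs nu : 'I_n -> 'rV[R]_d).

Lemma emean_EFin (a : 'I_n -> R) :
  emean (fun i => (a i)%:E) = (n%:R^-1 * \sum_i a i)%:E.
Proof. by rewrite /emean sumEFin EFinM. Qed.

Lemma emean_neqNy (a : 'I_n -> \bar R) :
  (forall i, a i != -oo%E) -> emean a != -oo%E.
Proof.
move=> aNy; rewrite /emean.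
have : (\sum_(i < n) a i)%E != -oo%E.
  by rewrite esum_eqNy; apply/negP => /existsP[i] /=; rewrite (negbTE (aNy i)).
case: (\sum_(i < n) a i)%E => [s||] // _.
by rewrite gt0_muley // lte_fin invr_gt0 ltr0n.
Qed.

Lemma emean_lty (a : 'I_n -> \bar R) : (forall i, a i != -oo%E) ->
  (emean a < +oo)%E -> forall i, a i \is a fin_num.
Proof.
move=> aNy + i; rewrite fin_numE aNy /=; apply: contraTneq => ai.
have -> : emean a = +oo%E; last by [].
have /eqP sy : (\sum_(i < n) a i)%E == +oo%E.
  by rewrite esum_eqy //; apply/existsP; exists i; rewrite ai eqxx.
by rewrite /emean sy gt0_muley // lte_fin invr_gt0 ltr0n.
Qed.

Lemma emeanD (a b : 'I_n -> \bar R) : (forall i, a i \is a fin_num) ->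
  emean (fun i => a i + b i)%E = (emean a + emean b)%E.
Proof.
move=> fa; rewrite /emean big_split /= muleDr //.
by apply: fin_num_adde_defr; apply/sum_fin_numP => i _ _; exact: fa.
Qed.

Lemma f_fin i x : f i x \is a fin_num. Proof. by have [] := hdf i x. Qed.

Lemma r_neqNy x : r x != -oo%E. Proof. by case: hr => _ _ []. Qed.

Lemma g_neqNy i x : g i x != -oo%E. Proof. by case: (hg i) => _ _ []. Qed.

Lemma fg_neqNy i x : (f i x + g i x)%E != -oo%E.
Proof. by have := g_neqNy i x; rewrite -(fineK (f_fin i x)); case: (g i x). Qed.

Lemma lagrangianE x xs nu : r x \is a fin_num ->
  (forall i, g i (xs i) \is a fin_num) ->
  lagrangian r f g x xs nu = (fine (r x) +
    n%:R^-1 * (\sum_i (fine (f i (xs i)) + fine (g i (xs i))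
               + dotv (nu i) (xs i - x))))%:E.
Proof.
move=> fr fg; rewrite /lagrangian.
have -> : (fun i => f i (xs i) + g i (xs i))%E =
    (fun i => (fine (f i (xs i)) + fine (g i (xs i)))%:E).
  by apply/funext => i; rewrite EFinD !fineK // f_fin.
by rewrite emean_EFin -[r x in LHS](fineK fr) -!EFinD -addrA -mulrDr -big_split.
Qed.

Lemma lagrangian_lty x xs nu : (lagrangian r f g x xs nu < +oo)%E ->
  r x \is a fin_num /\ forall i, g i (xs i) \is a fin_num.
Proof.
rewrite /lagrangian => lfin.
have eNy := emean_neqNy (fun i => fg_neqNy i (xs i)).
have : (emean (fun i => f i (xs i) + g i (xs i)) < +oo)%E.
  move: lfin eNy (r_neqNy x); case: (emean _) => [s||] //; first by rewrite ltry.
  by case: (r x) => [t||] //=.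
move=> /(emean_lty (fun i => fg_neqNy i (xs i))) fgfin; split.
  rewrite fin_numE r_neqNy /=; apply: contraTneq lfin => ->.
  by case: (emean _) eNy => [s||].
move=> i; move: (fgfin i); rewrite -(fineK (f_fin i (xs i))).
by case: (g i (xs i)).
Qed.

(** Minimality compares the Lagrangian with its value at a point where every
    function is finite, which exists by properness. *)
Lemma saddle_point_fin x xs nu : saddle_point r f g x xs nu ->
  r x \is a fin_num /\ forall i, g i (xs i) \is a fin_num.
Proof.
move=> [hmin _]; have [_ _ [_ [y ry]]] := hr.
have /fin_all_exists [ys gys] : forall i, exists v, g i v \is a fin_num.
  by move=> i; case: (hg i) => _ _ [].
apply: (@lagrangian_lty _ _ nu); apply: le_lt_trans (hmin y ys) _.
by rewrite lagrangianE // ltry.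
Qed.

(** The Lagrangian is affine in the multipliers, so maximality forces the
    coefficients [xs i - x] to vanish: move [nu] along them. *)
Lemma saddle_point_consensus x xs nu : saddle_point r f g x xs nu ->
  xs = fun=> x.
Proof.
move=> hs; have [rx gx] := saddle_point_fin hs; have [_ hmax] := hs.
have := hmax (fun i => nu i + (xs i - x)).
rewrite !lagrangianE // lee_fin lerD2l ler_pM2l ?invr_gt0 ?ltr0n //.
rewrite -subr_ge0 -sumrB => h.
have sq0 : \sum_i dotv (xs i - x) (xs i - x) <= 0.
  rewrite -oppr_ge0 -sumrN; apply: le_trans h _.
  by apply: ler_sum => i _; rewrite (dotvDl (nu i)); lra.
apply/funext => i; apply/eqP; rewrite -subr_eq0; apply/eqP/rowP => j.
have {}sq0 : \sum_i dotv (xs i - x) (xs i - x) = 0.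
  by apply/eqP; rewrite eq_le sq0 sumr_ge0 // => l _; exact: dotv_ge0.
have := psumr_eq0P (fun l _ => dotv_ge0 (xs l - x)) sq0 (i := i) isT.
rewrite /dotv => /psumr_eq0P h0.
apply/eqP; rewrite [X in _ == X]mxE -sqrf_eq0 expr2 h0 // => l _.
by rewrite -expr2 sqr_ge0.
Qed.

End Saddle.

(** The sum rule for subdifferentials in the smooth plus convex case: the smooth
    part is replaced by its linearization, at a cost that is quadratic in the
    step. *)
Lemma subgrad_of_sum {R : realType} {d : nat} (L : R)
    (h1 h2 : 'rV[R]_d -> \bar R) (x u : 'rV[R]_d) :
  differentiable_fun h1 -> 0 < L -> lipschitz_grad L h1 -> ccp h2 ->
  h2 x \is a fin_num ->
  (forall y, h2 y \is a fin_num ->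
    fine (h1 x) + fine (h2 x) + dotv u (y - x) <= fine (h1 y) + fine (h2 y)) ->
  subgrad h2 x (u - grad h1 x).
Proof.
move=> hdf L0 hLf [hconv _ [hNy _]] fx hmin; split => // y fy; rewrite -subr_le0.
apply: (@le0_of_small_bounds _ _ (L / 2 * dotv (y - x) (y - x))) => t /andP[t0 t1].
have := hconv y x t; rewrite (ltW t0) t1 => /(_ isT).
rewrite convex_comb_shift.
have := quadratic_approx hdf L0 hLf x (t *: (y - x)).
rewrite ler_norml => /andP[_] /=; rewrite !(dotvZl, dotvZr).
have := hmin (x + t *: (y - x)); rewrite [_ + _ - x]addrC addKr dotvZr.
rewrite -(fineK fx) -(fineK fy) -!EFinM -EFinD.
case: (h2 _) (hNy (x + t *: (y - x))) => [b _||//]; last by [].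
move=> /(_ isT) /= h3 h4; rewrite lee_fin => h5.
by rewrite (dotvDl u) dotvNl -(ler_pM2l t0); lra.
Qed.

Section SaddleSubgradients.
Context {R : realType} {d n : nat}.
Variables (r : 'rV[R]_d -> \bar R) (f g : 'I_n -> 'rV[R]_d -> \bar R) (L : R).
Hypotheses (hn : (0 < n)%N) (hr : ccp r) (hg : forall i, ccp (g i)).
Hypotheses (hdf : forall i, differentiable_fun (f i)) (L0 : 0 < L).
Hypothesis hLf : forall i, lipschitz_grad L (f i).
Variables (x0 : 'rV[R]_d) (nu : 'I_n -> 'rV[R]_d).
Hypothesis hs : saddle_point r f g x0 (fun=> x0) nu.

Lemma saddle_subgrad_r : subgrad r x0 (n%:R^-1 *: \sum_i nu i).
Proof.
have [rx gx] := saddle_point_fin hn hr hg hdf hs.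
split=> // y ry; have [hmin _] := hs.
have := hmin y (fun=> x0); rewrite !lagrangianE // lee_fin subrr.
have n0 : n%:R != 0 :> R by rewrite pnatr_eq0 -lt0n.
rewrite !big_split /= !mulrDr -!dotv_suml dotvZl.
rewrite -(opprB y x0) dotvNr dotv0r.
lra.
Qed.

Lemma saddle_subgrad_g i : subgrad (g i) x0 (- nu i - grad (f i) x0).
Proof.
have [rx gx] := saddle_point_fin hn hr hg hdf hs.
apply: (subgrad_of_sum (hdf i) L0 (hLf i)) => // y gy; have [hmin _] := hs.
have := hmin x0 (fun j => if j == i then y else x0).
rewrite !lagrangianE //; last by move=> j; case: eqP => [->|].
rewrite lee_fin lerD2l ler_pM2l ?invr_gt0 ?ltr0n //.
rewrite (bigD1 i) //= [leRHS](bigD1 i) //= eqxx.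
rewrite [X in _ <= _ + X](eq_bigr
  (fun j => fine (f j x0) + fine (g j x0) + dotv (nu j) (x0 - x0))).
  by rewrite lerD2r (subrr x0) dotvNl dotv0r; lra.
by move=> j /negbTE ->.
Qed.

Lemma objectiveE y :
  objective r f g y = (r y + emean (fun i => f i y) + emean (fun i => g i y))%E.
Proof. by rewrite /objective emeanD ?addeA // => i; exact: f_fin. Qed.

Lemma lagrangian_consensus y : lagrangian r f g y (fun=> y) nu = objective r f g y.
Proof.
rewrite /lagrangian /objective subrr big1 ?mulr0 ?adde0 // => i _.
by rewrite dotv0r.
Qed.

Lemma saddle_objective_le y : (objective r f g x0 <= objective r f g y)%E.
Proof. by have [hmin _] := hs; rewrite -!lagrangian_consensus. Qed.

Lemma objective_finE y : r y \is a fin_num -> (forall i, g i y \is a fin_num) ->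
  objective r f g y =
    (fine (r y) + n%:R^-1 * \sum_i (fine (f i y) + fine (g i y)))%:E.
Proof.
move=> fr fg; rewrite /objective.
have -> : (fun i => f i y + g i y)%E = (fun i => (fine (f i y) + fine (g i y))%:E).
  by apply/funext => i; rewrite EFinD !fineK // f_fin.
by rewrite emean_EFin -[r y in LHS](fineK fr).
Qed.

End SaddleSubgradients.

(** * One step of the method as a relation *)

Lemma subgrad_monotone {R : realType} {d : nat} (h : 'rV[R]_d -> \bar R)
    (p q u v : 'rV[R]_d) :
  subgrad h p u -> subgrad h q v -> 0 <= dotv (u - v) (p - q).
Proof.
move=> [fp hp] [fq hq]; have := hp q fq; have := hq p fp.
by rewrite -(opprB p q) dotvNr dotvDl dotvNl; lra.
Qed.

Section PPGStep.
Context {R : realType} {d n : nat}.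
Variables (r : 'rV[R]_d -> \bar R) (f g : 'I_n -> 'rV[R]_d -> \bar R).
Variables (L alpha : R).
Implicit Types (w : 'rV[R]_d) (z x : 'I_n -> 'rV[R]_d).

(** The optimality conditions of the two proximal steps, with [w] the
    intermediate point and [x] the new points. A fixed point of the method
    satisfies the same relation with all [x i] equal to [w], so that statements
    about two related triples apply to two iterates and to an iterate and a
    fixed point alike. *)
Definition ppg_relation z w x : Prop :=
  subgrad r w (alpha^-1 *: (n%:R^-1 *: (\sum_i z i) - w)) /\
  forall i, subgrad (g i) (x i)
    (alpha^-1 *: (2 *: w - z i - alpha *: grad (f i) w - x i)).

Definition sqdist z z' : R := \sum_i dotv (z i - z' i) (z i - z' i).

Lemma sqdist_ge0 z z' : 0 <= sqdist z z'.
Proof. by apply: sumr_ge0 => i _; exact: dotv_ge0. Qed.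

Hypotheses (hn : (0 < n)%N) (alpha0 : 0 < alpha) (L0 : 0 < L).

Lemma sum_ord_const (c : R) : \sum_(i < n) c = n%:R * c.
Proof. by rewrite sumr_const card_ord mulr_natl. Qed.

Lemma sum_dotv_mean_sub z w v :
  \sum_i dotv (z i - w) v = n%:R * dotv (n%:R^-1 *: (\sum_i z i) - w) v.
Proof.
rewrite (dotvDl _ (- w)) dotvNl dotvZl dotv_suml mulrBr mulrA divff ?mul1r; last first.
  by rewrite pnatr_eq0 -lt0n.
rewrite -sum_ord_const -sumrB.
by apply: eq_bigr => i _; rewrite dotvDl dotvNl.
Qed.

Lemma ppg_prox_r_monotone z w x z' w' x' :
  ppg_relation z w x -> ppg_relation z' w' x' ->
  0 <= \sum_i dotv (z i - z' i - (w - w')) (w - w').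
Proof.
move=> [hr _] [hr' _]; have := subgrad_monotone hr hr'.
rewrite -scalerBr dotvZl pmulr_rge0 ?invr_gt0 // => h.
rewrite (eq_bigr (fun i => dotv (z i - w) (w - w') - dotv (z' i - w') (w - w'))).
  rewrite sumrB !sum_dotv_mean_sub -mulrBr -dotvNl -dotvDl.
  by rewrite mulr_ge0 ?ler0n.
move=> i _; rewrite -dotvNl -dotvDl; congr (dotv _ _).
by apply/rowP => j; rewrite !mxE; ring.
Qed.

(** The proximal map of [r], applied to the mean, is nonexpansive. *)
Lemma ppg_shadow_le z w x z' w' x' :
  ppg_relation z w x -> ppg_relation z' w' x' ->
  n%:R * dotv (w - w') (w - w') <= sqdist z z'.
Proof.
move=> h h'; have := ppg_prox_r_monotone h h'.
rewrite -sum_ord_const => h1.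
rewrite -subr_ge0 /sqdist -sumrB; apply: le_trans (mulr_ge0 (ler0n R 2) h1) _.
rewrite mulr_sumr; apply: ler_sum => i _.
have := dotv_young (z i - z' i) (w - w') (@ltr01 R).
by rewrite invr1 !mul1r (dotvDl (z i - z' i)) dotvNl; lra.
Qed.

Hypotheses (hf : forall i, ccp (f i)) (hdf : forall i, differentiable_fun (f i)).
Hypothesis hLf : forall i, lipschitz_grad L (f i).

(** The algebra behind averagedness of the three-operator splitting map, for one
    index: [zeta], [a], [G] and [a + s] are the differences between two triples
    of z, w, the gradients and x. The first hypothesis is monotonicity of the
    subdifferential of [g i], the second cocoercivity of the gradient. Its
    surplus [2 * alpha / L * dotv G G] absorbs the cross term of [G] and [s]. *)
Lemma averaged_pointwise (zeta a s G : 'rV[R]_d) :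
  0 <= dotv (2 *: a - zeta - alpha *: G - (a + s)) (a + s) ->
  L^-1 * dotv G G <= dotv G a ->
  dotv (zeta + s) (zeta + s) + (1 - alpha * L / 2) * dotv s s
    <= dotv zeta zeta - 2 * dotv (zeta - a) a.
Proof.
move=> hg hG.
have h : alpha * (2 * dotv (- G) s) <=
    alpha * (2 / L * dotv G G + L / 2 * dotv s s).
  rewrite ler_pM2l //.
  have := dotv_young (- G) s (divr_gt0 (ltr0n R 2) L0).
  by rewrite invf_div [dotv (- G) (- G)]dotvNl dotvNr opprK.
have hG' : alpha * (2 / L * dotv G G) <= alpha * (2 * dotv G a).
  by rewrite ler_pM2l //; lra.
move: h hg; rewrite !dotvE (dotvC s zeta) (dotvC s a); lra.
Qed.

(** The map that sends z to the next z is averaged whenever [alpha * L < 2].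
    Monotonicity of the subdifferential of [r] enters only after summation over
    the indices, because its proximal map sees only the mean of z. *)
Lemma ppg_averaged z w x z' w' x' :
  ppg_relation z w x -> ppg_relation z' w' x' ->
  sqdist (fun i => z i + x i - w) (fun i => z' i + x' i - w')
    + (1 - alpha * L / 2) * sqdist (fun i => x i - w) (fun i => x' i - w')
  <= sqdist z z'.
Proof.
move=> h h'; have h1 := ppg_prox_r_monotone h h'.
have [_ hg] := h; have [_ hg'] := h'.
have step i :
   dotv (z i + x i - w - (z' i + x' i - w')) (z i + x i - w - (z' i + x' i - w'))
   + (1 - alpha * L / 2) * dotv (x i - w - (x' i - w')) (x i - w - (x' i - w'))
   <= dotv (z i - z' i) (z i - z' i) - 2 * dotv (z i - z' i - (w - w')) (w - w').
  set s := x i - w - (x' i - w'); set a := w - w'.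
  set G := grad (f i) w - grad (f i) w'.
  have -> : z i + x i - w - (z' i + x' i - w') = (z i - z' i) + s.
    by apply/rowP => j; rewrite !mxE; ring.
  apply: (averaged_pointwise (G := G)).
    have := subgrad_monotone (hg i) (hg' i).
    rewrite -scalerBr dotvZl pmulr_rge0 ?invr_gt0 //.
    have -> : x i - x' i = a + s by apply/rowP => j; rewrite !mxE; ring.
    suff -> : 2 *: w - z i - alpha *: grad (f i) w - x i
       - (2 *: w' - z' i - alpha *: grad (f i) w' - x' i) =
       2 *: a - (z i - z' i) - alpha *: G - (a + s) by [].
    by apply/rowP => j; rewrite !mxE; ring.
  have [hconv _ _] := hf i.
  exact: cocoercive (hdf i) L0 (hLf i) hconv _ _.
rewrite /sqdist mulr_sumr -big_split /=.
apply: le_trans (ler_sum _ (fun i _ => step i)) _.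
rewrite sumrB -mulr_sumr; lra.
Qed.

End PPGStep.

(** * The rate of the value gap *)

Section Rate.
Context {R : realType} {d n : nat}.
Variables (r : 'rV[R]_d -> \bar R) (f g : 'I_n -> 'rV[R]_d -> \bar R).
Variables (L alpha : R).
Hypotheses (hn : (0 < n)%N) (alpha0 : 0 < alpha) (L0 : 0 < L).
Hypotheses (hf : forall i, ccp (f i)) (hdf : forall i, differentiable_fun (f i)).
Hypothesis hLf : forall i, lipschitz_grad L (f i).
Implicit Types (z x : 'I_n -> 'rV[R]_d).
Local Notation rel := (ppg_relation r f g alpha).

(** [n] times the objective with [r] and the [f i] evaluated at [w] and each
    [g i] at its own copy [x i]. *)
Definition split_value (w : 'rV[R]_d) x : R :=
  n%:R * fine (r w) + \sum_i (fine (f i w) + fine (g i (x i))).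

(** Every subgradient that the relation provides at the first triple is used to
    bound the values at the second pair of points. Applied to an iterate and a
    fixed point this bounds the gap from above, and with the roles exchanged it
    bounds the gap from below. *)
Lemma split_value_diff_le z w x w' x' : rel z w x ->
  r w' \is a fin_num -> (forall i, g i (x' i) \is a fin_num) ->
  alpha * (split_value w x - split_value w' x') <=
  \sum_i (dotv (z i - w) (w - w') + alpha * dotv (grad (f i) w) (w - w')
    + dotv (2 *: w - z i - alpha *: grad (f i) w - x i) (x i - x' i)).
Proof.
move=> [[_ hr] hg] fr fg.
have Hr : alpha * (n%:R * fine (r w) - n%:R * fine (r w')) <=
    \sum_i dotv (z i - w) (w - w').
  rewrite sum_dotv_mean_sub // -mulrBr mulrCA ler_wpM2l ?ler0n //.
  have := hr _ fr; rewrite dotvZl -(opprB w w') dotvNr => h.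
  rewrite -(ler_pM2l (_ : 0 < alpha^-1)) ?invr_gt0 // mulKf ?gt_eqF //; lra.
have Hf i : alpha * (fine (f i w) - fine (f i w')) <=
    alpha * dotv (grad (f i) w) (w - w').
  have [hconv _ _] := hf i.
  have := convex_grad_ineq (hdf i) L0 (hLf i) hconv w w'.
  by rewrite -(opprB w w') dotvNr ler_pM2l //=; lra.
have Hg i : alpha * (fine (g i (x i)) - fine (g i (x' i))) <=
    dotv (2 *: w - z i - alpha *: grad (f i) w - x i) (x i - x' i).
  have [_ /(_ _ (fg i))] := hg i; rewrite dotvZl -(opprB (x i) (x' i)) dotvNr => h.
  rewrite -(ler_pM2l (_ : 0 < alpha^-1)) ?invr_gt0 // mulKf ?gt_eqF //; lra.
rewrite !big_split /= /split_value !big_split /=.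
have := ler_sum (P := xpredT) (index_enum 'I_n) (fun i _ => Hf i).
have := ler_sum (P := xpredT) (index_enum 'I_n) (fun i _ => Hg i).
rewrite -!mulr_sumr !sumrB; lra.
Qed.

(** Young's inequality with weight [1 / sqrt k] : if the [s i] have squared length
    O(1/k), their pairings with bounded vectors are O(1/sqrt k). *)
Lemma pairing_le_rsqrt (c s : 'I_n -> 'rV[R]_d) (M : R) (k : nat) : (0 < k)%N ->
  k%:R * (\sum_i dotv (s i) (s i)) <= M ->
  2 * \sum_i dotv (c i) (s i) <= (\sum_i dotv (c i) (c i) + M) / Num.sqrt k%:R.
Proof.
move=> k0 hM; set q := Num.sqrt k%:R.
have q0 : 0 < q by rewrite sqrtr_gt0 ltr0n.
have qq : q * q = k%:R by rewrite -expr2 sqr_sqrtr.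
rewrite mulr_sumr.
have young i : 2 * dotv (c i) (s i) <= q^-1 * dotv (c i) (c i) + q * dotv (s i) (s i).
  by have := dotv_young (c i) (s i) (c := q^-1); rewrite invr_gt0 invrK; exact.
apply: le_trans (ler_sum _ (fun i _ => young i)) _.
rewrite big_split /= -!mulr_sumr mulrC [leRHS]mulrDl lerD2l.
by rewrite ler_pdivlMr // mulrAC qq.
Qed.

Lemma dotv_sum4_le (a b c e : 'rV[R]_d) :
  dotv (a + b + c + e) (a + b + c + e)
    <= 4 * (dotv a a + dotv b b + dotv c c + dotv e e).
Proof.
have Y (u v : 'rV[R]_d) : 2 * dotv u v <= dotv u u + dotv v v.
  by have := dotv_young u v ltr01; rewrite invr1 !mul1r.
have := Y a b; have := Y a c; have := Y a e; have := Y b c; have := Y b e.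
have := Y c e; rewrite !dotvE (dotvC b a) (dotvC c a) (dotvC c b) (dotvC e a).
by rewrite (dotvC e b) (dotvC e c); lra.
Qed.

Variables (w : nat -> 'rV[R]_d) (x z : nat -> 'I_n -> 'rV[R]_d).
Variables (x0 : 'rV[R]_d) (zs : 'I_n -> 'rV[R]_d).
Hypothesis hrel : forall k, rel (z k) (w k) (x k.+1).
Hypothesis hz : forall k i, z k.+1 i = z k i + x k.+1 i - w k.
Hypothesis hfix : rel zs x0 (fun=> x0).
Hypothesis alphaL : alpha * L < 2.

(** The squared length of the step from [z k] to [z k.+1]. *)
Let D k : R := \sum_i dotv (x k.+1 i - w k) (x k.+1 i - w k).
(** The coefficient of the squared step in the averagedness inequality. *)
Let theta : R := 1 - alpha * L / 2.

Let theta0 : 0 < theta. Proof. by have := alphaL; rewrite /theta; lra. Qed.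

(** Averagedness against the fixed point. *)
Lemma fejer k : sqdist (z k.+1) zs + theta * D k <= sqdist (z k) zs.
Proof.
have := ppg_averaged hn alpha0 L0 hf hdf hLf (hrel k) hfix.
have -> : (fun i => z k i + x k.+1 i - w k) = z k.+1 by apply/funext => i.
have -> : (fun i => zs i + x0 - x0) = zs by apply/funext => i; rewrite addrK.
suff -> : sqdist (fun i => x k.+1 i - w k) (fun=> x0 - x0) = D k by [].
by apply: eq_bigr => i _; rewrite subrr subr0.
Qed.

(** Averagedness, hence nonexpansiveness, on consecutive iterates. *)
Lemma residual_noninc k : D k.+1 <= D k.
Proof.
have DE m : sqdist (z m.+1) (z m) = D m.
  apply: eq_bigr => i _; have -> // : z m.+1 i - z m i = x m.+1 i - w m.
  by rewrite hz; apply/rowP => j; rewrite !mxE; ring.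
have := ppg_averaged hn alpha0 L0 hf hdf hLf (hrel k.+1) (hrel k).
have -> : (fun i => z k.+1 i + x k.+2 i - w k.+1) = z k.+2 by apply/funext => i.
have -> : (fun i => z k i + x k.+1 i - w k) = z k.+1 by apply/funext => i.
rewrite !DE; apply: le_trans; rewrite lerDl mulr_ge0 ?(ltW theta0) //.
exact: sqdist_ge0.
Qed.

(** The steps are summable by [fejer] and nonincreasing, so the last one is at
    most the average of all. *)
Lemma residual_rate k :
  sqdist (z k.+1) zs + theta * (k.+1%:R * D k) <= sqdist (z 0) zs.
Proof.
elim: k => [|k IH]; first by rewrite mul1r; exact: fejer.
apply: le_trans IH; have := fejer k.+1.
have : theta * (k.+1%:R * D k.+1) <= theta * (k.+1%:R * D k).
  by rewrite !ler_wpM2l ?ler0n ?(ltW theta0) // residual_noninc.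
by rewrite (mulrSr 1 k.+1); lra.
Qed.

Let D_ge0 k : 0 <= D k.
Proof. by apply: sumr_ge0 => i _; exact: dotv_ge0. Qed.

Lemma sqdist_fix_le k : sqdist (z k) zs <= sqdist (z 0) zs.
Proof.
case: k => // k; apply: le_trans (residual_rate k).
by rewrite lerDl mulr_ge0 ?(ltW theta0) // mulr_ge0 ?ler0n.
Qed.

Lemma residual_le k : k%:R * D k <= sqdist (z 0) zs / theta.
Proof.
rewrite ler_pdivlMr //; have := residual_rate k; have := sqdist_ge0 (z k.+1) zs.
have : theta * (k%:R * D k) <= theta * (k.+1%:R * D k).
  by rewrite ler_pM2l // ler_wpM2r // ler_nat.
lra.
Qed.

Lemma residual_le0 k : D k <= D 0.
Proof. by elim: k => // k; apply: le_trans; exact: residual_noninc. Qed.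

Let fixr : r x0 \is a fin_num. Proof. by case: hfix => -[]. Qed.
Let fixg i : g i x0 \is a fin_num. Proof. by case: hfix => _ /(_ i)[]. Qed.
(** The coefficients of the steps in the lower and upper bounds on the gap; [b i]
    is [alpha] times the subgradient of [g i] at the fixed point. *)
Let b i := x0 - zs i - alpha *: grad (f i) x0.
Let c k i := x0 - z k i - (x k.+1 i - w k) - alpha *: grad (f i) (w k).

Lemma gap_upper k :
  alpha * (split_value (w k) (x k.+1) - split_value x0 (fun=> x0)) <=
  \sum_i dotv (c k i) (x k.+1 i - w k).
Proof.
apply: le_trans (split_value_diff_le (hrel k) fixr fixg) _.
apply: ler_sum => i _; rewrite /c.
set s := x k.+1 i - w k; set e := w k - x0; set G := grad _ _.
have -> : x k.+1 i - x0 = e + s by apply/rowP => j; rewrite !mxE; ring.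
have -> : x0 - z k i - s - alpha *: G = (w k - z k i) - e - s - alpha *: G.
  by apply/rowP => j; rewrite !mxE; ring.
have -> : 2 *: w k - z k i - alpha *: G - x k.+1 i = (w k - z k i) - alpha *: G - s.
  by apply/rowP => j; rewrite !mxE; ring.
rewrite -(opprB (w k) (z k i)) dotvNl; move: (w k - z k i) => y; clearbody s e G.
by rewrite !dotvE (dotvC s e); lra.
Qed.

Lemma gap_lower k :
  - (alpha * (split_value (w k) (x k.+1) - split_value x0 (fun=> x0))) <=
  \sum_i dotv (- b i) (x k.+1 i - w k).
Proof.
have [[fw _] hx] := hrel k.
rewrite -mulrN opprB.
apply: le_trans (split_value_diff_le hfix fw (fun i => (hx i).1)) _.
apply: ler_sum => i _; rewrite /b.
set s := x k.+1 i - w k; set e := x0 - w k; set G := grad _ _.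
have -> : x0 - x k.+1 i = e - s by apply/rowP => j; rewrite !mxE; ring.
have -> : 2 *: x0 - zs i - alpha *: G - x0 = x0 - zs i - alpha *: G.
  by apply/rowP => j; rewrite !mxE; ring.
rewrite -(opprB x0 (zs i)) dotvNl; move: (x0 - zs i) => y; clearbody s e G.
by rewrite !dotvE; lra.
Qed.

(** A bound on the coefficients that depends only on the starting point: each
    [c k i] is [b i] plus differences that the Fejer property, the decrease of
    the steps and Lipschitz continuity of the gradients control. *)
Let K : R := 4 * (\sum_i dotv (b i) (b i) + sqdist (z 0) zs + D 0
  + alpha ^+ 2 * (L ^+ 2 * sqdist (z 0) zs)).

Lemma gap_coefficients_le k : \sum_i dotv (c k i) (c k i) <= K.
Proof.
have step i : dotv (c k i) (c k i) <= 4 * (dotv (b i) (b i)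
    + dotv (z k i - zs i) (z k i - zs i)
    + dotv (x k.+1 i - w k) (x k.+1 i - w k)
    + alpha ^+ 2 * (L ^+ 2 * dotv (w k - x0) (w k - x0))).
  have -> : c k i = b i + (- (z k i - zs i)) + (- (x k.+1 i - w k))
       + (- (alpha *: (grad (f i) (w k) - grad (f i) x0))).
    by rewrite /c /b; apply/rowP => j; rewrite !mxE; ring.
  apply: le_trans (dotv_sum4_le _ _ _ _) _.
  rewrite ler_pM2l // !(dotvNl (_ - _)) !(dotvNr (_ - _)) !opprK lerD2l.
  rewrite (dotvNl (_ *: _)) dotvNr opprK dotvZl dotvZr mulrA -expr2.
  rewrite ler_wpM2l ?sqr_ge0 //; exact: norm2_le_sqr (hLf i _ _).
apply: le_trans (ler_sum _ (fun i _ => step i)) _.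
rewrite -mulr_sumr /K ler_pM2l // !big_split /= !lerD //.
- exact: sqdist_fix_le.
- exact: residual_le0.
rewrite -!mulr_sumr !ler_wpM2l ?sqr_ge0 // sum_ord_const.
exact: le_trans (ppg_shadow_le hn alpha0 (hrel k) hfix) (sqdist_fix_le k).
Qed.

Lemma split_value_rate : exists C : R, forall k, (0 < k)%N ->
  `| split_value (w k) (x k.+1) - split_value x0 (fun=> x0) | <=
  C / Num.sqrt k%:R.
Proof.
exists ((K + sqdist (z 0) zs / theta) / (2 * alpha)) => k k0.
set v := split_value _ _ - _; set M := sqdist (z 0) zs / theta.
have M0 := residual_le k.
have bK : \sum_i dotv (- b i) (- b i) <= K.
  have V0 := sqdist_ge0 (z 0) zs; have D0 := D_ge0 0.
  have : 0 <= alpha ^+ 2 * (L ^+ 2 * sqdist (z 0) zs).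
    by rewrite mulr_ge0 ?sqr_ge0 // mulr_ge0 ?sqr_ge0.
  have : 0 <= \sum_i dotv (b i) (b i) by apply: sumr_ge0 => i _; exact: dotv_ge0.
  have bN i : dotv (- b i) (- b i) = dotv (b i) (b i) by rewrite dotvNl dotvNr opprK.
  rewrite (eq_bigr _ (fun i _ => bN i)).
  rewrite /K; lra.
have bound (e : 'I_n -> 'rV[R]_d) : \sum_i dotv (e i) (e i) <= K ->
    2 * \sum_i dotv (e i) (x k.+1 i - w k) <= (K + M) / Num.sqrt k%:R.
  move=> eK; apply: le_trans (pairing_le_rsqrt e k0 M0) _.
  by rewrite ler_pM2r ?invr_gt0 ?sqrtr_gt0 ?ltr0n // lerD2r.
have up := bound _ (gap_coefficients_le k); have lo := bound _ bK.
rewrite mulrAC ler_pdivlMr ?mulr_gt0 //.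
have := gap_upper k; have := gap_lower k; rewrite -/v => l u.
have -> : `|v| * (2 * alpha) = `|2 * (alpha * v)|.
  by rewrite !normrM (gtr0_norm alpha0) normr_nat; ring.
by rewrite ler_norml; apply/andP; split; lra.
Qed.

End Rate.

(** * The bound for the iteration *)

(** The gap may be measured at any minimizer, since only the optimal value
    enters; for the point of a saddle all terms are finite. *)
Lemma PPG_gapE {R : realType} {d n : nat} (r : 'rV[R]_d -> \bar R)
    (f g : 'I_n -> 'rV[R]_d -> \bar R) (xstar x0 : 'rV[R]_d)
    (xh : nat -> 'rV[R]_d) (x : nat -> 'I_n -> 'rV[R]_d) (k : nat) :
  (0 < n)%N -> (forall i, differentiable_fun (f i)) ->
  objective r f g xstar = objective r f g x0 ->
  r x0 \is a fin_num -> (forall i, g i x0 \is a fin_num) ->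
  r (xh k) \is a fin_num -> (forall i, g i (x k.+1 i) \is a fin_num) ->
  PPG_gap r f g xstar xh x k =
    (n%:R^-1 * (split_value r f g (xh k) (x k.+1)
                - split_value r f g x0 (fun=> x0)))%:E.
Proof.
move=> hn hdf hobj rx0 gx0 rxh gx.
have n0 : n%:R != 0 :> R by rewrite pnatr_eq0 -lt0n.
have mean_fine (h : 'I_n -> 'rV[R]_d -> \bar R) (y : 'I_n -> 'rV[R]_d) :
    (forall i, h i (y i) \is a fin_num) ->
    emean (fun i => h i (y i)) = (n%:R^-1 * \sum_i fine (h i (y i)))%:E.
  move=> hfin; rewrite -emean_EFin; congr emean.
  by apply/funext => i; rewrite fineK.
rewrite /PPG_gap -objectiveE // hobj objective_finE //.
rewrite (mean_fine f (fun=> xh k)) => [|i]; last exact: f_fin.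
rewrite (mean_fine g (x k.+1)) // -[r (xh k)](fineK rxh) -!EFinD.
congr (_%:E); rewrite /split_value /= !big_split /=.
by field.
Qed.

Theorem theorem2 (R : realType) (d n : nat) (hn : (0 < n)%N)
    (r : 'rV[R]_d -> \bar R) (f g : 'I_n -> 'rV[R]_d -> \bar R)
    (L alpha : R)
    (hr : ccp r) (hf : forall i, ccp (f i)) (hg : forall i, ccp (g i))
    (hdf : forall i, differentiable_fun (f i))
    (hL : 0 < L) (hLf : forall i, lipschitz_grad L (f i))
    (hsaddle : exists (x : 'rV[R]_d) (xs nu : 'I_n -> 'rV[R]_d),
      saddle_point r f g x xs nu)
    (halpha : 0 < alpha < 3 / (2 * L))
    (xh : nat -> 'rV[R]_d) (x z : nat -> 'I_n -> 'rV[R]_d)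
    (hPPG : PPG alpha r f g xh x z)
    (xstar : 'rV[R]_d) (hxstar : argmin (objective r f g) xstar) :
  exists C : R, \forall k \near \oo,
    (`| PPG_gap r f g xstar xh x k | <= (C / Num.sqrt k%:R)%R%:E)%E.
Proof.
have [x0 [xs [nu hs]]] := hsaddle.
have [rx0 gxs] := saddle_point_fin hn hr hg hdf hs.
have xsE := saddle_point_consensus hn hr hg hdf hs; subst xs.
case/andP: halpha => alpha0 alpha_lt.
have alphaL : alpha * L < 2.
  by move: alpha_lt; rewrite ltr_pdivlMr ?mulr_gt0 //; lra.
have step k : ppg_relation r f g alpha (z k) (xh k) (x k.+1).
  have [hxh hx _] := hPPG k; split; first by rewrite hxh; exact: prox_subgrad.
  by move=> i; rewrite hx; exact: prox_subgrad.
have hz k i : z k.+1 i = z k i + x k.+1 i - xh k by have [] := hPPG k.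
have n0 : n%:R != 0 :> R by rewrite pnatr_eq0 -lt0n.
(* z^* = x^* + alpha nu is a fixed point: its mean minus x^* is alpha times the
   mean multiplier, and reflecting it leaves - alpha (nu_i + grad f_i). *)
have fix0 : ppg_relation r f g alpha (fun i => x0 + alpha *: nu i) x0 (fun=> x0).
  split=> [|i].
    have := saddle_subgrad_r hn hr hg hdf hs; congr (subgrad r x0 _).
    rewrite big_split /= sumr_const card_ord -scaler_sumr -(scaler_nat n x0).
    by apply/rowP => j; rewrite !mxE; field; rewrite n0 gt_eqF.
  have := saddle_subgrad_g hn hr hg hdf hL hLf hs i; congr (subgrad (g i) x0 _).
  by apply/rowP => j; rewrite !mxE; field; rewrite gt_eqF.
have [C hC] := split_value_rate hn alpha0 hL hf hdf hLf step hz fix0 alphaL.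
exists (n%:R^-1 * C); near=> k.
have k0 : (0 < k)%N by near: k; exact: nbhs_infty_gt.
have hobj : objective r f g xstar = objective r f g x0.
  apply/eqP; rewrite eq_le hxstar /=.
  exact: saddle_objective_le hs xstar.
rewrite (PPG_gapE _ _ hobj) //; first last.
- by move=> i; case: (step k) => _ /(_ i)[].
- by case: (step k) => -[].
rewrite lee_fin normrM gtr0_norm ?invr_gt0 ?ltr0n // -mulrA.
by rewrite ler_pM2l ?invr_gt0 ?ltr0n //; exact: hC.
Unshelve. all: by end_near.
Qed.
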